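(* The Whittaker vector $\omega=\sum_{d_1,d_2\ge0}\omega_{d_1,d_2}$ in the Verma module $\mathcal V_v$ over $U_v(\mathfrak{sl}_3)$ and the dual Whittaker vector $\bar\omega=\sum_{d_1,d_2\ge0}\bar\omega_{d_1,d_2}$ in the Verma module $\mathcal V_{v^{-1}}$ over $U_{v^{-1}}(\mathfrak{sl}_3)$ exist, are unique, and are given by $$\omega_{d_1,d_2}=\sum_{n=0}^{\min(d_1,d_2)} \omega_{d_1,d_2,n},\qquad \bar \omega_{d_1,d_2}=\sum_{n=0}^{\min(d_1,d_2)}\bar \omega_{d_1,d_2,n},$$ where $$\omega_{d_1,d_2,n}=\frac{v^{r(d_1,d_2,n)}}{(1-v^2)^{d_1+d_2}}\sqrt{c(d_1,d_2,n)}\; m_{d_1,d_2,n},\qquad \bar\omega_{d_1,d_2,n}=\frac{v^{-r(d_1,d_2,n)+s(d_1,d_2)}}{(1-v^{-2})^{d_1+d_2}}\sqrt{c(d_1,d_2,n)}\;\bar m_{d_1,d_2,n},$$ with $r,s,c$ and the Gelfand–Tsetlin bases $m_{d_1,d_2,n},\bar m_{d_1,d_2,n}$ as defined in the context.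
   Context: **Quantum groups.** $U_v(\mathfrak{sl}_3)$ is the $\mathbb C(v)$-algebra with generators $K_i^{\pm1},E_i,F_i$ ($i=1,2$) and relations, for $i\ne j$: $K_iK_i^{-1}=1$, $K_iK_j=K_jK_i$, $K_iE_i=v^2E_iK_i$, $K_iF_i=v^{-2}F_iK_i$, $K_iE_j=v^{-1}E_jK_i$, $K_iF_j=vF_jK_i$, $E_iF_i-F_iE_i=\frac{K_i-K_i^{-1}}{v-v^{-1}}$, $E_iF_j=F_jE_i$, $E_i^2E_j-(v+v^{-1})E_iE_jE_i+E_jE_i^2=0$, $F_i^2F_j-(v+v^{-1})F_iF_jF_i+F_jF_i^2=0$. $U_{v^{-1}}(\mathfrak{sl}_3)$ is the same with $v$ replaced by $v^{-1}$; its generators are written $\bar K_i^{\pm1},\bar E_i,\bar F_i$. **Coefficients.** $\lambda_1,\lambda_2$ are formal variables, $\lambda_3=-\lambda_1-\lambda_2$. Let $\mathcal R$ be the ring spanned by all square roots $\sqrt g$, $g\in\mathbb C(v,v^{\lambda_1},v^{\lambda_2})$ (inside a fixed algebraic closure); scalars are extended to $\mathcal R$. Put $[a]=\frac{v^a-v^{-a}}{v-v^{-1}}$, $[a]!=\prod_{i=1}^a[i]$, $[a]_b=\prod_{i=0}^{b-1}[a+i]$. A square root $\sqrt{[x]}$ is fixed once for each $x$ that is a positive integer or of the form $\lambda_i-\lambda_j+\text{integer}$ with $i<j$, and square roots of products and quotients of such $[x]$ are defined multiplicatively ($\sqrt0=0$). **Verma modules.** $\mathcal V_v$ is the $U_v(\mathfrak{sl}_3)$-module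 generated by $w$ with defining relations $K_1w=v^{\lambda_1-\lambda_2}w$, $K_2w=v^{\lambda_2-\lambda_3}w$, $E_1w=E_2w=0$. $\mathcal V_{v^{-1}}$ is the $U_{v^{-1}}(\mathfrak{sl}_3)$-module generated by $\bar w$ with defining relations $\bar K_1\bar w=v^{\lambda_2-\lambda_1}\bar w$, $\bar K_2\bar w=v^{\lambda_3-\lambda_2}\bar w$, $\bar E_1\bar w=\bar E_2\bar w=0$. Weight spaces: $\mathcal V_v(d_1,d_2)$ is the subspace where $K_1=v^{\lambda_1-\lambda_2-2d_1+d_2}$, $K_2=v^{\lambda_2-\lambda_3-2d_2+d_1}$; $\mathcal V_{v^{-1}}(d_1,d_2)$ is the subspace where $\bar K_1=v^{\lambda_2-\lambda_1+2d_1-d_2}$, $\bar K_2=v^{\lambda_3-\lambda_2+2d_2-d_1}$. **Gelfand–Tsetlin bases.** $\mathcal V_v$ has the basis $\{m_{d_1,d_2,n}: d_1,d_2,n\in\mathbb Z_{\ge0},\ n\le\min(d_1,d_2)\}$ with $m_{0,0,0}=w$, $m_{d_1,d_2,n}\in\mathcal V_v(d_1,d_2)$, and $$\begin{aligned}E_1m_{d_1,d_2,n}&=\sqrt{b_1(d_1,d_2,n)}\,m_{d_1-1,d_2,n-1}+\sqrt{b_2(d_1,d_2,n)}\,m_{d_1-1,d_2,n},\\ F_1m_{d_1,d_2,n}&=\sqrt{b_1(d_1+1,d_2,n+1)}\,m_{d_1+1,d_2,n+1}+\sqrt{b_2(d_1+1,d_2,n)}\,m_{d_1+1,d_2,n},\\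 E_2m_{d_1,d_2,n}&=\sqrt{a(d_1,d_2,n)}\,m_{d_1,d_2-1,n},\qquad F_2m_{d_1,d_2,n}=\sqrt{a(d_1,d_2+1,n)}\,m_{d_1,d_2+1,n},\end{aligned}$$ where $$\begin{aligned}a(d_1,d_2,n)&=[d_2-n][\lambda_2-\lambda_3+d_1-d_2-n+1],\\ b_1(d_1,d_2,n)&=\frac{[d_2-n+1][n][\lambda_2-\lambda_3-n+1][\lambda_1-\lambda_3-n+2]}{[\lambda_2-\lambda_3+d_1-2n+1][\lambda_2-\lambda_3+d_1-2n+2]},\\ b_2(d_1,d_2,n)&=\frac{[d_1-n][\lambda_2-\lambda_3+d_1-d_2-n][\lambda_2-\lambda_3+d_1-n+1][\lambda_1-\lambda_2-d_1+n+1]}{[\lambda_2-\lambda_3+d_1-2n][\lambda_2-\lambda_3+d_1-2n+1]}.\end{aligned}$$ $\mathcal V_{v^{-1}}$ has the analogous basis $\bar m_{d_1,d_2,n}\in\mathcal V_{v^{-1}}(d_1,d_2)$, $\bar m_{0,0,0}=\bar w$, on which $\bar E_i,\bar F_i$ act by the same formulas. **Whittaker vectors.** A Whittaker vector is a series $\omega=\sum_{d_1,d_2\ge0}\omega_{d_1,d_2}$, $\omega_{d_1,d_2}\in\mathcal V_v(d_1,d_2)$, with $\omega_{0,0}=w$ and $E_1K_1^{-1}\omega_{d_1,d_2}=\frac1{1-v^2}\omega_{d_1-1,d_2}$, $E_2\omega_{d_1,d_2}=\frac1{1-v^2}\omega_{d_1,d_2-1}$. A dual Whittaker vector is a series $\bar\omega=\sum_{d_1,d_2\ge0}\bar\omega_{d_1,d_2}$,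 $\bar\omega_{d_1,d_2}\in\mathcal V_{v^{-1}}(d_1,d_2)$, with $\bar\omega_{0,0}=\bar w$ and $\bar E_1\bar\omega_{d_1,d_2}=\frac v{1-v^{-2}}\bar\omega_{d_1-1,d_2}$, $\bar E_2\bar K_2\bar\omega_{d_1,d_2}=\frac v{1-v^{-2}}\bar\omega_{d_1,d_2-1}$. Terms with a negative index are zero. **Coefficients of the formula.** $$r(d_1,d_2,n)=(\lambda_2-\lambda_3+d_1+1)n-n^2+(\lambda_1-\lambda_2-1)d_1-d_1^2,$$ $$s(d_1,d_2)=-d_1^2-d_2^2+d_1d_2+(\lambda_1-\lambda_2)d_1+(\lambda_2-\lambda_3)d_2,$$ $$c(d_1,d_2,n)=\frac{1}{[d_1-n]!\,[d_2-n]!\,[n]!}\cdot\frac{1}{[\lambda_1-\lambda_2-d_1+n+1]_{d_1-n}[\lambda_1-\lambda_3-n+2]_n[\lambda_2-\lambda_3+2]_{d_1-n}}\cdot\frac{[\lambda_2-\lambda_3+2]_\infty/[\lambda_2-\lambda_3+d_1-2n+2]_\infty}{[\lambda_2-\lambda_3+d_1-d_2-n+1]_{d_2-n}[\lambda_2-\lambda_3-n+1]_n},$$ where $[\lambda_2-\lambda_3+2]_\infty/[\lambda_2-\lambda_3+d_1-2n+2]_\infty$ means $[\lambda_2-\lambda_3+2]_{d_1-2n}$ if $d_1\ge2n$ and $1/[\lambda_2-\lambda_3+d_1-2n+2]_{2n-d_1}$ if $d_1<2n$. *)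

(* Defs.v *)
From HB Require Import structures.
From mathcomp Require Import all_boot all_order all_algebra.
From mathcomp Require Import boolp reals complex mpoly.

Set Implicit Arguments.
Unset Strict Implicit.
Unset Printing Implicit Defensive.

Import GRing.Theory.
Local Open Scope ring_scope.

(* C(v, v^lambda_1, v^lambda_2), in three algebraically independent variables
   'X_0 = v, 'X_1 = v^lambda_1 and 'X_2 = v^lambda_2. *)
Definition ratfun (R : realType) : fieldType := {fraction {mpoly R[i][3]}}.

Definition ratfun_var (R : realType) (k : 'I_3) : ratfun R :=
  tofrac ('X_k : {mpoly R[i][3]}).

(* The subring of K spanned over iota(F) by the square roots of the elements
   of iota(F): finite sums of f * y with f in iota(F) and y ^+ 2 in iota(F). *)
Section SqrtRing.

Variables (F K : fieldType) (iota : {rmorphism F -> K}).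

Definition sqrt_span : {pred K} := fun x : K =>
  `[< exists s : seq (F * K),
        (forall p, p \in s -> exists g : F, p.2 ^+ 2 = iota g)
        /\ x = \sum_(p <- s) iota p.1 * p.2 >].

Lemma sqrt_span_sqrt (g : F) (y : K) : y ^+ 2 = iota g -> y \in sqrt_span.
Proof.
move=> yg; apply/asboolP; exists [:: (1, y)]; split; last first.
  by rewrite big_seq1 rmorph1 mul1r.
by move=> p; rewrite inE => /eqP ->; exists g.
Qed.

Lemma sqrt_span_base (f : F) : iota f \in sqrt_span.
Proof. by apply: (@sqrt_span_sqrt (f ^+ 2)); rewrite rmorphXn. Qed.

Lemma sqrt_span_subring : subring_closed sqrt_span.
Proof.
split.
- by rewrite -(rmorph1 iota); apply: sqrt_span_base.
- move=> _ _ /asboolP[s [hs ->]] /asboolP[t [ht ->]]; apply/asboolP.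
  exists (s ++ [seq (- p.1, p.2) | p <- t]); split.
    move=> p; rewrite mem_cat => /orP[/hs //|/mapP[p' /ht hp' ->]].
    exact: hp'.
  rewrite big_cat big_map /= -sumrN; congr (_ + _).
  by apply: eq_bigr => p _; rewrite rmorphN mulNr.
- move=> _ _ /asboolP[s [hs ->]] /asboolP[t [ht ->]]; apply/asboolP.
  exists [seq (p.1 * p'.1, p.2 * p'.2) | p <- s, p' <- t]; split.
    move=> _ /allpairsP[[p p'] /= [/hs [g gE] /ht [g' g'E] ->]] /=.
    by exists (g * g'); rewrite exprMn gE g'E rmorphM.
  rewrite big_allpairs_dep mulr_suml; apply: eq_bigr => p _.
  rewrite mulr_sumr; apply: eq_bigr => p' _.
  by rewrite rmorphM mulrACA.
Qed.

HB.instance Definition _ :=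
  GRing.isSubringClosed.Build K sqrt_span sqrt_span_subring.

Lemma sqrt_span_algebraic x : x \in sqrt_span -> algebraicOver iota x.
Proof.
move=> /asboolP[s [hs ->]]; elim: s hs => [|p s IHs] hs.
  by rewrite big_nil; apply: algebraic0.
rewrite big_cons; apply: algebraic_add; last first.
  by apply: IHs => p' p's; apply: hs; rewrite inE p's orbT.
apply: algebraic_mul; first exact: algebraic_id.
have [|g gE] := hs p; first by rewrite mem_head.
exists ('X^2 - g%:P); first by rewrite monic_neq0 // monicXnsubC.
by rewrite rmorphB /= map_polyXn map_polyC /root !hornerE gE subrr.
Qed.

Lemma sqrt_span_inv x : x \in sqrt_span -> x^-1 \in sqrt_span.
Proof.
move=> xS; have [->|x0] := eqVneq x 0; first by rewrite invr0 rpred0.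
have evalS (q : {poly F}) : (map_poly iota q).[x] \in sqrt_span.
  rewrite horner_coef rpred_sum // => i _.
  by rewrite rpredM ?rpredX // coef_map sqrt_span_base.
suff main n (p : {poly F}) : (size p < n)%N -> p != 0 ->
    root (map_poly iota p) x -> x^-1 \in sqrt_span.
  have [p p0 px] := sqrt_span_algebraic xS.
  exact: main (ltnSn _) p0 px.
elim: n p => // n IHn; elim/poly_ind => [|q c _]; first by rewrite eqxx.
have [->|c0] := eqVneq c 0.
  rewrite addr0 => leqn; rewrite mulf_eq0 polyX_eq0 orbF => q0.
  rewrite rmorphM /= map_polyX rootM rootX (negbTE x0) orbF => qx.
  by apply: (IHn q) => //; move: leqn; rewrite size_mulX.
move=> _ _; rewrite rmorphD rmorphM /= map_polyX map_polyC /root !hornerE.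
rewrite addr_eq0 => /eqP qxE.
suff -> : x^-1 = - (map_poly iota q).[x] * iota c^-1.
  by rewrite rpredM ?rpredN ?sqrt_span_base.
have ic0 : iota c != 0 by rewrite fmorph_eq0.
by apply: (mulIf x0); rewrite mulVf // mulrAC mulNr qxE opprK fmorphV mulfV.
Qed.

Lemma sqrt_span_divring : divring_closed sqrt_span.
Proof.
have [S1 SB SM] := sqrt_span_subring.
by split=> // x y xS yS; apply: SM => //; apply: sqrt_span_inv.
Qed.

HB.instance Definition _ :=
  GRing.isDivringClosed.Build K sqrt_span sqrt_span_divring.

Definition sqrt_ring := {x : K | x \in sqrt_span}.

HB.instance Definition _ := SubChoice.on sqrt_ring.
HB.instance Definition _ :=
  [SubChoice_isSubIntegralDomain of sqrt_ring by <:].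
HB.instance Definition _ := [SubIntegralDomain_isSubField of sqrt_ring by <:].

Definition sqrt_ring_in (f : F) : sqrt_ring := Sub (iota f) (sqrt_span_base f).

End SqrtRing.

(* (p, q, k) stands for the exponent p lambda_1 + q lambda_2 + k. *)
Definition qexp : zmodType := (int * int * int)%type.

Definition cst (k : int) : qexp := (0, 0, k).
Definition lam1 : qexp := (1, 0, 0).
Definition lam2 : qexp := (0, 1, 0).
Definition lam3 : qexp := - lam1 - lam2.

(* The x for which a square root of [x] is chosen. *)
Definition has_qsqrt (x : qexp) : Prop :=
  (exists2 k : int, 0 < k & x = cst k) \/
  (exists k : int, [\/ x = lam1 - lam2 + cst k, x = lam1 - lam3 + cst k
                     | x = lam2 - lam3 + cst k]).

Section QuantumNumbers.

Variables (L : fieldType) (v t1 t2 : L).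

(* v^x, where t1 = v^lambda_1 and t2 = v^lambda_2. *)
Definition qpow (x : qexp) : L := t1 ^ x.1.1 * t2 ^ x.1.2 * v ^ x.2.

Definition qnum (x : qexp) : L := (qpow x - qpow (- x)) / (v - v^-1).

Definition qsqrt_choice (sq : qexp -> L) : Prop :=
  sq 0 = 0 /\ forall x, has_qsqrt x -> sq x ^+ 2 = qnum x.

End QuantumNumbers.

(* The products and quotients below take the bracket as a parameter br: they
   are the quantities a, b_1, b_2, c themselves for br = qnum v t1 t2, and,
   square roots being multiplicative, sqrt a, sqrt b_1, sqrt b_2, sqrt c when
   br x is the chosen square root of [x]. *)
Section Coefficients.

Variables (L : fieldType) (br : qexp -> L).

Definition qfact (a : nat) : L := \prod_(1 <= i < a.+1) br (cst i).

Definition qpoch (a : qexp) (b : nat) : L := \prod_(0 <= i < b) br (a + cst i).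

Definition gt_a (d1 d2 n : nat) : L :=
  br (cst (d2%:Z - n%:Z)) * br (lam2 - lam3 + cst (d1%:Z - d2%:Z - n%:Z + 1)).

Definition gt_b1 (d1 d2 n : nat) : L :=
  br (cst (d2%:Z - n%:Z + 1)) * br (cst n) *
  br (lam2 - lam3 + cst (- n%:Z + 1)) * br (lam1 - lam3 + cst (- n%:Z + 2)) /
  (br (lam2 - lam3 + cst (d1%:Z - 2 * n%:Z + 1)) *
   br (lam2 - lam3 + cst (d1%:Z - 2 * n%:Z + 2))).

Definition gt_b2 (d1 d2 n : nat) : L :=
  br (cst (d1%:Z - n%:Z)) * br (lam2 - lam3 + cst (d1%:Z - d2%:Z - n%:Z)) *
  br (lam2 - lam3 + cst (d1%:Z - n%:Z + 1)) *
  br (lam1 - lam2 + cst (- d1%:Z + n%:Z + 1)) /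
  (br (lam2 - lam3 + cst (d1%:Z - 2 * n%:Z)) *
   br (lam2 - lam3 + cst (d1%:Z - 2 * n%:Z + 1))).

(* [lambda_2 - lambda_3 + 2]_oo / [lambda_2 - lambda_3 + d1 - 2 n + 2]_oo *)
Definition qpoch_ratio (d1 n : nat) : L :=
  if (2 * n <= d1)%N then qpoch (lam2 - lam3 + cst 2) (d1 - 2 * n)
  else (qpoch (lam2 - lam3 + cst (d1%:Z - 2 * n%:Z + 2)) (2 * n - d1))^-1.

(* Only meaningful for n <= minn d1 d2, when no subtraction on nat is
   truncated. *)
Definition whit_c (d1 d2 n : nat) : L :=
  1 / (qfact (d1 - n) * qfact (d2 - n) * qfact n) *
  (1 / (qpoch (lam1 - lam2 + cst (- d1%:Z + n%:Z + 1)) (d1 - n) *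
        qpoch (lam1 - lam3 + cst (- n%:Z + 2)) n *
        qpoch (lam2 - lam3 + cst 2) (d1 - n))) *
  (qpoch_ratio d1 n /
   (qpoch (lam2 - lam3 + cst (d1%:Z - d2%:Z - n%:Z + 1)) (d2 - n) *
    qpoch (lam2 - lam3 + cst (- n%:Z + 1)) n)).

End Coefficients.

Definition whit_r (d1 d2 n : nat) : qexp :=
  (lam2 - lam3 + cst (d1%:Z + 1)) *+ n - cst (n%:Z ^+ 2)
  + (lam1 - lam2 - cst 1) *+ d1 - cst (d1%:Z ^+ 2).

Definition whit_s (d1 d2 : nat) : qexp :=
  cst (- d1%:Z ^+ 2 - d2%:Z ^+ 2 + d1%:Z * d2%:Z)
  + (lam1 - lam2) *+ d1 + (lam2 - lam3) *+ d2.

(* Operators by which the generators K_i, K_i^-1, E_i, F_i act; i : 'I_2 is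
   shifted by one from the index in {1, 2}. *)
Record uq_ops (L : fieldType) (V : lmodType L) := UqOps {
  opK : 'I_2 -> {linear V -> V};
  opKV : 'I_2 -> {linear V -> V};
  opE : 'I_2 -> {linear V -> V};
  opF : 'I_2 -> {linear V -> V} }.

Local Notation i1 := (ord0 : 'I_2).
Local Notation i2 := (ord_max : 'I_2).

(* The defining relations of U_q(sl_3): operators satisfying them are the same
   as a module over U_q(sl_3) with scalars extended to L. *)
Record uq_module (L : fieldType) (q : L) (V : lmodType L) (A : uq_ops V) :
    Prop := UqModule {
  uq_KKV : forall i x, opK A i (opKV A i x) = x;
  uq_KVK : forall i x, opKV A i (opK A i x) = x;
  uq_KK : forall i j x, opK A i (opK A j x) = opK A j (opK A i x);
  uq_KE : forall i x, opK A i (opE A i x) = q ^+ 2 *: opE A i (opK A i x);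
  uq_KF : forall i x, opK A i (opF A i x) = q ^- 2 *: opF A i (opK A i x);
  uq_KE' : forall i j x, i != j ->
    opK A i (opE A j x) = q^-1 *: opE A j (opK A i x);
  uq_KF' : forall i j x, i != j ->
    opK A i (opF A j x) = q *: opF A j (opK A i x);
  uq_EF : forall i x, opE A i (opF A i x) - opF A i (opE A i x) =
    (q - q^-1)^-1 *: (opK A i x - opKV A i x);
  uq_EF' : forall i j x, i != j -> opE A i (opF A j x) = opF A j (opE A i x);
  uq_EEE : forall i j x, i != j ->
    opE A i (opE A i (opE A j x)) - (q + q^-1) *: opE A i (opE A j (opE A i x))
    + opE A j (opE A i (opE A i x)) = 0;
  uq_FFF : forall i j x, i != j ->
    opF A i (opF A i (opF A j x)) - (q + q^-1) *: opF A i (opF A j (opF A i x))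
    + opF A j (opF A i (opF A i x)) = 0 }.

Definition uq_morphism (L : fieldType) (V W : lmodType L) (A : uq_ops V)
    (B : uq_ops W) (f : {linear V -> W}) : Prop :=
  forall i x, [/\ f (opK A i x) = opK B i (f x),
                  f (opKV A i x) = opKV B i (f x),
                  f (opE A i x) = opE B i (f x) &
                  f (opF A i x) = opF B i (f x)].

(* w satisfies K_1 w = k1 w, K_2 w = k2 w, E_1 w = E_2 w = 0. *)
Definition highest_weight (L : fieldType) (k1 k2 : L) (V : lmodType L)
    (A : uq_ops V) (w : V) : Prop :=
  [/\ opK A i1 w = k1 *: w, opK A i2 w = k2 *: w,
      opE A i1 w = 0 & opE A i2 w = 0].

(* V is the module presented by the generator w and the defining relations
   [highest_weight], i.e. the universal module with such an element. *)
Record verma (L : fieldType) (q k1 k2 : L) (V : lmodType L) (A : uq_ops V)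
    (w : V) : Prop := Verma {
  verma_module : uq_module q A;
  verma_gen : highest_weight k1 k2 A w;
  verma_lift : forall (W : lmodType L) (B : uq_ops W) (x : W),
    uq_module q B -> highest_weight k1 k2 B x ->
    exists2 f : {linear V -> W}, uq_morphism A B f & f w = x;
  verma_uniq : forall (W : lmodType L) (B : uq_ops W) (f g : {linear V -> W}),
    uq_module q B -> uq_morphism A B f -> uq_morphism A B g -> f w = g w ->
    f =1 g }.

Definition basis_on (L : fieldType) (V : lmodType L) (I : eqType)
    (P : pred I) (b : I -> V) : Prop :=
  (forall (s : seq I) (c : I -> L), uniq s -> all P s ->
     \sum_(i <- s) c i *: b i = 0 -> forall i, i \in s -> c i = 0) /\
  (forall x : V, exists (s : seq I) (c : I -> L),
     all P s /\ x = \sum_(i <- s) c i *: b i).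

Section Whittaker.

Variables (L : fieldType) (v t1 t2 : L) (V : lmodType L) (A : uq_ops V) (w : V).

Local Notation "v^[ x ]" := (qpow v t1 t2 x) (format "v^[ x ]").

(* The subspace V_v(d1, d2). *)
Definition wtspace (d1 d2 : nat) (x : V) : Prop :=
  opK A i1 x = v^[lam1 - lam2 + cst (- 2 * d1%:Z + d2%:Z)] *: x /\
  opK A i2 x = v^[lam2 - lam3 + cst (- 2 * d2%:Z + d1%:Z)] *: x.

(* The subspace V_{v^-1}(d1, d2). *)
Definition wtspace_dual (d1 d2 : nat) (x : V) : Prop :=
  opK A i1 x = v^[lam2 - lam1 + cst (2 * d1%:Z - d2%:Z)] *: x /\
  opK A i2 x = v^[lam3 - lam2 + cst (2 * d2%:Z - d1%:Z)] *: x.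

(* Gelfand-Tsetlin bases, for the weight spaces wt and the chosen square roots
   sq x of [x].  Only the values m d1 d2 n with n <= minn d1 d2 matter: whenever
   one of the indices on the right of the formulas for E_i and F_i leaves this
   range (in particular when .-1 is truncated), its coefficient has a factor
   sq 0 = 0. *)
Record gt_basis (wt : nat -> nat -> V -> Prop) (sq : qexp -> L)
    (m : nat -> nat -> nat -> V) : Prop := GTBasis {
  gt_basisP : basis_on
    (fun d : nat * nat * nat => (d.2 <= minn d.1.1 d.1.2)%N)
    (fun d => m d.1.1 d.1.2 d.2);
  gt_000 : m 0%N 0%N 0%N = w;
  gt_wt : forall d1 d2 n, (n <= minn d1 d2)%N -> wt d1 d2 (m d1 d2 n);
  gt_E1 : forall d1 d2 n, (n <= minn d1 d2)%N ->
    opE A i1 (m d1 d2 n) = gt_b1 sq d1 d2 n *: m d1.-1 d2 n.-1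
                           + gt_b2 sq d1 d2 n *: m d1.-1 d2 n;
  gt_F1 : forall d1 d2 n, (n <= minn d1 d2)%N ->
    opF A i1 (m d1 d2 n) = gt_b1 sq d1.+1 d2 n.+1 *: m d1.+1 d2 n.+1
                           + gt_b2 sq d1.+1 d2 n *: m d1.+1 d2 n;
  gt_E2 : forall d1 d2 n, (n <= minn d1 d2)%N ->
    opE A i2 (m d1 d2 n) = gt_a sq d1 d2 n *: m d1 d2.-1 n;
  gt_F2 : forall d1 d2 n, (n <= minn d1 d2)%N ->
    opF A i2 (m d1 d2 n) = gt_a sq d1 d2.+1 n *: m d1 d2.+1 n }.

(* The series sum_(d1, d2) om d1 d2 is encoded by its family of components;
   the terms om (-1) d2 and om d1 (-1) are zero. *)
Definition shift1 (om : nat -> nat -> V) (d1 d2 : nat) : V :=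
  if d1 is d.+1 then om d d2 else 0.
Definition shift2 (om : nat -> nat -> V) (d1 d2 : nat) : V :=
  if d2 is d.+1 then om d1 d else 0.

Definition whittaker (om : nat -> nat -> V) : Prop :=
  [/\ om 0%N 0%N = w,
      (forall d1 d2, wtspace d1 d2 (om d1 d2)),
      (forall d1 d2, opE A i1 (opKV A i1 (om d1 d2)) =
         (1 / (1 - v ^+ 2)) *: shift1 om d1 d2) &
      (forall d1 d2, opE A i2 (om d1 d2) =
         (1 / (1 - v ^+ 2)) *: shift2 om d1 d2)].

Definition dual_whittaker (om : nat -> nat -> V) : Prop :=
  [/\ om 0%N 0%N = w,
      (forall d1 d2, wtspace_dual d1 d2 (om d1 d2)),
      (forall d1 d2, opE A i1 (om d1 d2) =
         (v / (1 - v ^- 2)) *: shift1 om d1 d2) &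
      (forall d1 d2, opE A i2 (opK A i2 (om d1 d2)) =
         (v / (1 - v ^- 2)) *: shift2 om d1 d2)].

Definition whittaker_term (sq : qexp -> L) (m : nat -> nat -> nat -> V)
    (d1 d2 n : nat) : V :=
  (v^[whit_r d1 d2 n] / (1 - v ^+ 2) ^+ (d1 + d2) * whit_c sq d1 d2 n)
    *: m d1 d2 n.

Definition dual_whittaker_term (sq : qexp -> L) (m : nat -> nat -> nat -> V)
    (d1 d2 n : nat) : V :=
  (v^[- whit_r d1 d2 n + whit_s d1 d2] / (1 - v ^- 2) ^+ (d1 + d2)
    * whit_c sq d1 d2 n) *: m d1 d2 n.

End Whittaker.

Section FormalVariables.

Variables (R : realType) (K : fieldType) (iota : {rmorphism ratfun R -> K}).

Definition vv : sqrt_ring iota := sqrt_ring_in iota (ratfun_var R 0).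
Definition vlam1 : sqrt_ring iota := sqrt_ring_in iota (ratfun_var R 1).
Definition vlam2 : sqrt_ring iota := sqrt_ring_in iota (ratfun_var R 2).

End FormalVariables.

(* Main.v *)
Require Import Defs.
From mathcomp Require Import all_boot all_order all_algebra.
From mathcomp Require Import reals.
From mathcomp Require Import boolp complex mpoly zify ring.

Import GRing.Theory.
Local Open Scope ring_scope.

(** In the Gelfand-Tsetlin basis both Whittaker systems become scalar
recursions.  A component is a weight vector, so K_1^-1 (for the Whittaker
vector) and K_2 (for the dual one) act on it by a scalar; moving that scalar to
the right leaves a system of the form E_i om(d) = e_i(d) om(d - e_i), the
predicate [raising] below, and both halves of the theorem are statements about
such systems.

Uniqueness.  The difference of two solutions is, at the first place where they
differ, a weight vector of weight (d1, d2) <> (0, 0) killed by E_1 and E_2.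
Weights are told apart by their eigenvalues, so this vector is a combination of
the m_{d1,d2,n} alone ([weight_space_gt_comb]).  Since E_2 preserves n and
sqrt a vanishes only at n = d2, only n = d2 may survive; E_1 then lowers that
vector along a nonzero sqrt b_1 (or sqrt b_2 if d2 = 0), so it vanishes too
([singular_eq0]).

Existence.  Write X = lambda_2 - lambda_3 + d1 + 1 - 2n and a = d2 - n.
Almost all factors of c cancel in the products
   sqrt c(d1, d2+1, n)   sqrt a(d1, d2+1, n)    = sqrt c(d1, d2, n),
   sqrt c(d1+1, d2, n)   sqrt b_2(d1+1, d2, n)   = sqrt c(d1, d2, n) [X-a]/[X],
   sqrt c(d1+1, d2, n+1) sqrt b_1(d1+1, d2, n+1) = sqrt c(d1, d2, n) [a]/[X];
in the last two every surviving square root appears twice, so that no square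
root of a bracket is left ([whit_c_a], [whit_c_b2], [whit_c_b1]).  The exponents
satisfy r(d1+1, d2, n+1) - r(d1+1, d2, n) = X, and the equation for E_1 reduces
to v^X [a] + [X - a] = v^a [X] for the Whittaker vector and to its image under
v -> v^-1 for the dual one ([qnum_addl], [qnum_addlN]).

All divisions are legitimate because [x] = 0 only for x = 0, which is the
algebraic independence of v, v^lambda_1 and v^lambda_2 ([formal_qpow_eq1]). *)

Local Notation i1 := (ord0 : 'I_2).
Local Notation i2 := (ord_max : 'I_2).

(** * Exponents *)

Lemma qexp_eq (x y : qexp) :
  x.1.1 = y.1.1 -> x.1.2 = y.1.2 -> x.2 = y.2 -> x = y.
Proof. by case: x y => [[a b] c] [[a' b'] c'] /= -> -> ->. Qed.

Lemma cstD (k l : int) : cst (k + l) = cst k + cst l.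
Proof. by []. Qed.

Lemma has_qsqrt_cst (n : nat) : has_qsqrt (cst n.+1).
Proof. by left; exists n.+1. Qed.

Lemma has_qsqrt12 (k : int) : has_qsqrt (lam1 - lam2 + cst k).
Proof. by right; exists k; constructor. Qed.

Lemma has_qsqrt13 (k : int) : has_qsqrt (lam1 - lam3 + cst k).
Proof. by right; exists k; constructor. Qed.

Lemma has_qsqrt23 (k : int) : has_qsqrt (lam2 - lam3 + cst k).
Proof. by right; exists k; constructor. Qed.

Lemma has_qsqrt_neq0 (x : qexp) : has_qsqrt x -> x != 0.
Proof.
move=> [[k k_gt0 ->]|[k [] ->]].
- by apply: contraTneq k_gt0 => -[->].
- by apply/eqP => -[].
- by apply/eqP => -[].
- by apply/eqP => -[].
Qed.

(** The coordinates of r on lambda_1, lambda_2 and 1: in this form identities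
between exponents are identities between integers. *)
Lemma whit_rE (d1 d2 n : nat) : whit_r d1 d2 n =
  (n%:Z + d1%:Z, 2 * n%:Z - d1%:Z,
   (d1%:Z + 1) * n%:Z - n%:Z ^+ 2 - d1%:Z - d1%:Z ^+ 2).
Proof.
rewrite /whit_r; congr (_, _, _); rewrite /= ?raddfMn /= ?raddfMn /=; ring.
Qed.

Lemma whit_sE (d1 d2 : nat) : whit_s d1 d2 =
  (d1%:Z + d2%:Z, 2 * d2%:Z - d1%:Z,
   - d1%:Z ^+ 2 - d2%:Z ^+ 2 + d1%:Z * d2%:Z) :> qexp.
Proof.
rewrite /whit_s; congr (_, _, _); rewrite /= ?raddfMn /= ?raddfMn /=; ring.
Qed.

(** * Coefficients *)

Section CoefficientRecursions.

Variables (L : fieldType) (br : qexp -> L).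

Lemma qfactS (n : nat) : qfact br n.+1 = qfact br n * br (cst n.+1).
Proof. by rewrite /qfact big_nat_recr. Qed.

Lemma qpochS (x : qexp) (k : int) (n : nat) :
  qpoch br (x + cst k) n.+1 = br (x + cst k) * qpoch br (x + cst (k + 1)) n.
Proof.
rewrite /qpoch big_nat_recl //= addr0; congr (_ * _).
by apply: eq_bigr => i _; rewrite -!addrA -!cstD -addrA.
Qed.

Lemma qpochSr (x : qexp) (k : int) (n : nat) :
  qpoch br (x + cst k) n.+1 = qpoch br (x + cst k) n * br (x + cst (k + n%:Z)).
Proof. by rewrite /qpoch big_nat_recr //= -addrA -cstD. Qed.

Hypothesis br_neq0 : forall x, has_qsqrt x -> br x != 0.

Lemma qfact_neq0 (n : nat) : qfact br n != 0.
Proof.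
elim: n => [|n IHn]; first by rewrite /qfact big_geq ?oner_neq0.
by rewrite qfactS mulf_neq0 ?br_neq0 //; apply: has_qsqrt_cst.
Qed.

Lemma qpoch_neq0 (x : qexp) (n : nat) :
  (forall k, has_qsqrt (x + cst k)) -> qpoch br x n != 0.
Proof.
by move=> hx; rewrite prodf_seq_neq0; apply/allP => i _; apply: br_neq0.
Qed.

Lemma qpoch12_neq0 (k : int) (n : nat) : qpoch br (lam1 - lam2 + cst k) n != 0.
Proof.
by apply: qpoch_neq0 => l; rewrite -addrA -cstD; apply: has_qsqrt12.
Qed.

Lemma qpoch13_neq0 (k : int) (n : nat) : qpoch br (lam1 - lam3 + cst k) n != 0.
Proof.
by apply: qpoch_neq0 => l; rewrite -addrA -cstD; apply: has_qsqrt13.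
Qed.

Lemma qpoch23_neq0 (k : int) (n : nat) : qpoch br (lam2 - lam3 + cst k) n != 0.
Proof.
by apply: qpoch_neq0 => l; rewrite -addrA -cstD; apply: has_qsqrt23.
Qed.

(** The two cases in the definition of the ratio are the positive and the
negative powers of one product, so the same recursion holds across the boundary
d = 2n. *)
Lemma qpoch_ratioSl (d n : nat) : qpoch_ratio br d.+1 n =
  qpoch_ratio br d n * br (lam2 - lam3 + cst (d%:Z - 2 * n%:Z + 2)).
Proof.
rewrite /qpoch_ratio; have [led|ltd] := leqP (2 * n) d.
  rewrite (leq_trans led) // subSn // qpochSr; congr (_ * br (_ + cst _)); lia.
have -> : (2 * n - d = (2 * n - d.+1).+1)%N by lia.
rewrite qpochS; set b := br _.
have b0 : b != 0 by apply/br_neq0/has_qsqrt23.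
rewrite invfM mulrAC mulVf // mul1r.
have -> : d%:Z - 2 * n%:Z + 2 + 1 = d.+1%:Z - 2 * n%:Z + 2 by lia.
case: leqP => // led.
have [-> ->] : (d.+1 - 2 * n = 0 /\ 2 * n - d.+1 = 0)%N by lia.
by rewrite /qpoch !big_geq // invr1.
Qed.

(** The ratio depends on d1 - 2n only. *)
Lemma qpoch_ratio_diag (d n : nat) :
  qpoch_ratio br d.+2 n.+1 = qpoch_ratio br d n.
Proof.
rewrite /qpoch_ratio mulnS !subSS ltnS ltnS.
by have -> : d.+2%:Z - 2 * n.+1%:Z + 2 = d%:Z - 2 * n%:Z + 2 by lia.
Qed.

Lemma qpoch_ratioSS (d n : nat) : qpoch_ratio br d.+1 n.+1 =
  qpoch_ratio br d n / br (lam2 - lam3 + cst (d%:Z - 2 * n%:Z + 1)).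
Proof.
have b0 := br_neq0 _ (has_qsqrt23 (d%:Z - 2 * n%:Z + 1)).
apply: (mulIf b0); rewrite divfK // -[RHS]qpoch_ratio_diag [RHS]qpoch_ratioSl.
by congr (_ * br (_ + cst _)); lia.
Qed.

Lemma whit_c000 : whit_c br 0 0 0 = 1.
Proof.
by rewrite /whit_c /qpoch_ratio /qfact /qpoch /= !big_geq // !(mulr1, invr1).
Qed.

(** The recursions for c are rational identities in the brackets, valid for any
function [br] that does not vanish on the admissible arguments; this is what
allows them to be used for the square roots of the brackets. *)
Lemma whit_c_a (d1 d2 n : nat) : (n <= d1)%N -> (n <= d2)%N ->
  whit_c br d1 d2.+1 n * gt_a br d1 d2.+1 n = whit_c br d1 d2 n.
Proof.
move=> /subnKC <- /subnKC <-; move: (d1 - n)%N (d2 - n)%N => p q.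
rewrite -addnS /whit_c /gt_a !addKn qfactS qpochS.
have -> : (n + q.+1)%:Z - n%:Z = q.+1 by lia.
set k : int := (n + p)%:Z - (n + q.+1)%:Z - n%:Z + 1.
have -> : (n + p)%:Z - (n + q)%:Z - n%:Z + 1 = k + 1 by rewrite /k; lia.
field.
rewrite !qfact_neq0 !qpoch12_neq0 !qpoch13_neq0 !qpoch23_neq0.
by rewrite (br_neq0 _ (has_qsqrt23 _)) (br_neq0 _ (has_qsqrt_cst _)).
Qed.

(** Here and in [whit_c_b1] the brackets that do not cancel come in squares:
for br x = sqrt [x] the right-hand side no longer involves square roots other
than sqrt c. *)
Lemma whit_c_b2 (d1 d2 n : nat) : (n <= d1)%N -> (n <= d2)%N ->
  whit_c br d1.+1 d2 n * gt_b2 br d1.+1 d2 n = whit_c br d1 d2 n *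
    (br (lam2 - lam3 + cst (d1.+1%:Z - d2%:Z - n%:Z)) ^+ 2 /
     br (lam2 - lam3 + cst (d1.+1%:Z - 2 * n%:Z)) ^+ 2).
Proof.
move=> /subnKC <- /subnKC <-; move: (d1 - n)%N (d2 - n)%N => p q.
rewrite -addnS /whit_c /gt_b2 !addKn qfactS addnS qpoch_ratioSl -addnS.
rewrite [qpoch br (lam1 - lam2 + _) p.+1]qpochS.
rewrite [qpoch br (lam2 - lam3 + cst 2) p.+1]qpochSr.
have -> : (n + p.+1)%:Z - n%:Z = p.+1 by lia.
have -> : - (n + p)%:Z + n%:Z + 1 = - (n + p.+1)%:Z + n%:Z + 1 + 1 by lia.
have -> : p.+1%:Z + 1 = 2 + p%:Z by lia.
have -> : (n + p.+1)%:Z - 2 * n%:Z + 1 = (n + p)%:Z - 2 * n%:Z + 2 by lia.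
set k := (n + p.+1)%:Z - (n + q)%:Z - n%:Z.
have -> : (n + p)%:Z - (n + q)%:Z - n%:Z + 1 = k by rewrite /k; lia.
(* The symbols of length q starting at k and at k + 1 are both compared with
   the symbol of length q + 1 starting at k. *)
have pochE : br (lam2 - lam3 + cst k) * qpoch br (lam2 - lam3 + cst (k + 1)) q
    = qpoch br (lam2 - lam3 + cst k) q
      * br (lam2 - lam3 + cst ((n + p.+1)%:Z - 2 * n%:Z)).
  rewrite -qpochS qpochSr; congr (_ * br (_ + cst _)); rewrite /k; lia.
have -> : qpoch br (lam2 - lam3 + cst (k + 1)) q =
    qpoch br (lam2 - lam3 + cst k) q
    * br (lam2 - lam3 + cst ((n + p.+1)%:Z - 2 * n%:Z))
    / br (lam2 - lam3 + cst k).
  by rewrite -pochE mulrAC mulfV ?mul1r ?br_neq0 //; apply: has_qsqrt23.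
field.
rewrite !qfact_neq0 !qpoch12_neq0 !qpoch13_neq0 !qpoch23_neq0.
by rewrite !(br_neq0 _ (has_qsqrt23 _)) !(br_neq0 _ (has_qsqrt12 _))
  (br_neq0 _ (has_qsqrt_cst _)).
Qed.

Lemma whit_c_b1 (d1 d2 n : nat) : (n <= d1)%N -> (n < d2)%N ->
  whit_c br d1.+1 d2 n.+1 * gt_b1 br d1.+1 d2 n.+1 = whit_c br d1 d2 n *
    (br (cst (d2%:Z - n%:Z)) ^+ 2 /
     br (lam2 - lam3 + cst (d1.+1%:Z - 2 * n%:Z)) ^+ 2).
Proof.
move=> /subnKC <- /subnKC <-; move: (d1 - n)%N (d2 - n.+1)%N => p q.
have subE : (n.+1 + q - n = q.+1)%N by lia.
rewrite /whit_c /gt_b1 subSS !addKn subE qpoch_ratioSS !qfactS.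
rewrite [qpoch br (lam1 - lam3 + _) n.+1]qpochS.
rewrite [qpoch br (lam2 - lam3 + cst (- _ + 1)) n.+1]qpochS.
rewrite [qpoch br (lam2 - lam3 + cst (_ - n%:Z + 1)) q.+1]qpochSr.
have -> : (n.+1 + q)%:Z - n.+1%:Z + 1 = q.+1%:Z by lia.
have -> : (n.+1 + q)%:Z - n%:Z = q.+1%:Z by lia.
have -> : - n.+1%:Z + 1 + 1 = - n%:Z + 1 by lia.
have -> : - n.+1%:Z + 2 + 1 = - n%:Z + 2 by lia.
have -> : - (n + p).+1%:Z + n.+1%:Z + 1 = - (n + p)%:Z + n%:Z + 1 by lia.
have -> : (n + p)%:Z - 2 * n%:Z + 1 = (n + p).+1%:Z - 2 * n%:Z by lia.
have -> : (n + p).+1%:Z - 2 * n.+1%:Z + 2 = (n + p).+1%:Z - 2 * n%:Z by lia.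
set k := (n + p).+1%:Z - (n.+1 + q)%:Z - n.+1%:Z + 1.
have -> : (n + p)%:Z - (n.+1 + q)%:Z - n%:Z + 1 = k by rewrite /k; lia.
have -> : k + q%:Z = (n + p).+1%:Z - 2 * n.+1%:Z + 1 by rewrite /k; lia.
field.
rewrite !qfact_neq0 !qpoch12_neq0 !qpoch13_neq0 !qpoch23_neq0.
by rewrite !(br_neq0 _ (has_qsqrt23 _)) !(br_neq0 _ (has_qsqrt13 _))
  !(br_neq0 _ (has_qsqrt_cst _)).
Qed.

End CoefficientRecursions.

(** * Gelfand-Tsetlin modules *)

Section RaisingSystem.

Variables (L : fieldType) (br : qexp -> L).
Hypothesis br0 : br 0 = 0.
Hypothesis br_neq0 : forall x, has_qsqrt x -> br x != 0.

(** The four vanishing statements [gt_b1_n0], [gt_b1_out], [gt_b2_out] and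
[gt_a_out] are why sums over the basis may be reindexed freely: a basis index
leaves the range n <= min(d1, d2) only with coefficient zero. *)
Lemma gt_b1_n0 (d1 d2 : nat) : gt_b1 br d1 d2 0 = 0.
Proof. by rewrite /gt_b1 [br (cst 0)]br0 mulr0 !mul0r. Qed.

Lemma gt_b1_out (d1 d2 : nat) : gt_b1 br d1 d2 d2.+1 = 0.
Proof.
rewrite /gt_b1; have -> : d2%:Z - d2.+1%:Z + 1 = 0 by lia.
by rewrite [br (cst 0)]br0 !mul0r.
Qed.

Lemma gt_b1_neq0 (d1 d2 n : nat) : (n < d2)%N -> gt_b1 br d1 d2 n.+1 != 0.
Proof.
move=> ltnd; rewrite /gt_b1.
have -> : d2%:Z - n.+1%:Z + 1 = (d2 - n.+1).+1%:Z by lia.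
by rewrite !(mulf_neq0, invr_neq0) // ?(br_neq0 _ (has_qsqrt_cst _))
  ?(br_neq0 _ (has_qsqrt23 _)) ?(br_neq0 _ (has_qsqrt13 _)).
Qed.

Lemma gt_b2_out (d1 d2 : nat) : gt_b2 br d1 d2 d1 = 0.
Proof. by rewrite /gt_b2 subrr [br (cst 0)]br0 !mul0r. Qed.

Lemma gt_b2_neq0 (d1 d2 n : nat) : (n <= d1)%N -> gt_b2 br d1.+1 d2 n != 0.
Proof.
move=> lend; rewrite /gt_b2.
have -> : d1.+1%:Z - n%:Z = (d1 - n).+1%:Z by lia.
by rewrite !(mulf_neq0, invr_neq0) // ?(br_neq0 _ (has_qsqrt_cst _))
  ?(br_neq0 _ (has_qsqrt23 _)) ?(br_neq0 _ (has_qsqrt12 _)).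
Qed.

Lemma gt_a_out (d1 d2 : nat) : gt_a br d1 d2 d2 = 0.
Proof. by rewrite /gt_a subrr [br (cst 0)]br0 mul0r. Qed.

Lemma gt_a_neq0 (d1 d2 n : nat) : (n <= d2)%N -> gt_a br d1 d2.+1 n != 0.
Proof.
move=> lend; rewrite /gt_a.
have -> : d2.+1%:Z - n%:Z = (d2 - n).+1%:Z by lia.
by rewrite mulf_neq0 ?(br_neq0 _ (has_qsqrt_cst _))
  ?(br_neq0 _ (has_qsqrt23 _)).
Qed.

Variables (V : lmodType L) (A : uq_ops V) (w : V).
Variables (k1 k2 : nat -> nat -> L) (m : nat -> nat -> nat -> V).

Definition weight_space (d1 d2 : nat) (x : V) : Prop :=
  opK A i1 x = k1 d1 d2 *: x /\ opK A i2 x = k2 d1 d2 *: x.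

Hypothesis weight_inj : forall d1 d2 e1 e2,
  k1 d1 d2 = k1 e1 e2 -> k2 d1 d2 = k2 e1 e2 -> (d1, d2) = (e1, e2).
Hypothesis mP : gt_basis A w weight_space br m.

Lemma weight_space_comb (d1 d2 : nat) (a : L) (x y : V) :
  weight_space d1 d2 x -> weight_space d1 d2 y ->
  weight_space d1 d2 (a *: x + y).
Proof.
by move=> [x1 x2] [y1 y2]; split;
  rewrite linearP ?x1 ?y1 ?x2 ?y2 scalerDr !scalerA mulrC.
Qed.

Definition gt_comb (d1 d2 : nat) (C : nat -> L) : V :=
  \sum_(0 <= n < (minn d1 d2).+1) C n *: m d1 d2 n.

Lemma eq_gt_comb (d1 d2 : nat) (C D : nat -> L) :
  (forall n, (n <= minn d1 d2)%N -> C n = D n) ->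
  gt_comb d1 d2 C = gt_comb d1 d2 D.
Proof.
move=> CD; rewrite /gt_comb !big_mkord; apply: eq_bigr => i _.
by rewrite CD // -ltnS.
Qed.

Lemma gt_combZ (d1 d2 : nat) (a : L) (C : nat -> L) :
  a *: gt_comb d1 d2 C = gt_comb d1 d2 (fun n => a * C n).
Proof. by rewrite scaler_sumr; apply: eq_bigr => n _; rewrite scalerA. Qed.

Lemma weight_gt_comb (d1 d2 : nat) (C : nat -> L) :
  weight_space d1 d2 (gt_comb d1 d2 C).
Proof.
rewrite /gt_comb big_mkord; elim/big_ind: _ => [|x y wx wy|i _].
- by split; rewrite linear0 scaler0.
- by rewrite -[x]scale1r; apply: weight_space_comb.
- rewrite -[_ *: _]addr0; apply: weight_space_comb.
    by apply: (gt_wt mP); rewrite -ltnS.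
  by split; rewrite linear0 scaler0.
Qed.

(** Linear independence of the basis, restricted to one weight. *)
Lemma gt_comb_eq0 (d1 d2 : nat) (C : nat -> L) : gt_comb d1 d2 C = 0 ->
  forall n, (n <= minn d1 d2)%N -> C n = 0.
Proof.
move=> C0 n le_n; have [free _] := gt_basisP mP.
pose s := [seq (d1, d2, k) | k <- index_iota 0 (minn d1 d2).+1].
apply: (free s (fun d => C d.2) _ _ _ (d1, d2, n)).
- by rewrite map_inj_uniq ?iota_uniq // => x y [].
- by apply/allP => _ /mapP[k + ->]; rewrite mem_index_iota.
- by rewrite big_map.
- by apply: map_f; rewrite mem_index_iota.
Qed.

(** Applying K_i - k_i to the expansion of a weight vector multiplies each
coefficient by a difference of eigenvalues, so by linear independence a basis
vector with a nonzero coefficient has the same weight. *)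
Lemma weight_space_gt_comb (d1 d2 : nat) (x : V) : weight_space d1 d2 x ->
  exists C, x = gt_comb d1 d2 C.
Proof.
move=> [x1 x2]; have [free span] := gt_basisP mP.
have [s0 [c0 [Ps0 xE0]]] := span x.
pose b (d : nat * nat * nat) := m d.1.1 d.1.2 d.2.
(* The spanning family may contain repetitions, whereas linear independence
   needs distinct indices: equal terms are first collected. *)
pose s := undup s0; pose c d := c0 d *+ count_mem d s0.
have us : uniq s by apply: undup_uniq.
have Ps : all (fun d => (d.2 <= minn d.1.1 d.1.2)%N) s.
  by apply/allP => d; rewrite mem_undup; apply: (allP Ps0).
have xE : x = \sum_(d <- s) c d *: b d.
  rewrite xE0 -big_undup_iterop_count; apply: eq_bigr => d _.
  by rewrite Monoid.iteropE iter_addr_0 scalerMnl.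
have cross (i : 'I_2) (k : nat -> nat -> L) :
    (forall d, d \in s -> opK A i (b d) = k d.1.1 d.1.2 *: b d) ->
    opK A i x = k d1 d2 *: x ->
    forall d, d \in s -> c d != 0 -> k d.1.1 d.1.2 = k d1 d2.
  move=> kb kx d ds cd0.
  have /eqP : c d * (k d.1.1 d.1.2 - k d1 d2) = 0.
    apply: (free s (fun d => c d * (k d.1.1 d.1.2 - k d1 d2))) => //.
    transitivity (opK A i x - k d1 d2 *: x); last by rewrite kx subrr.
    rewrite xE linear_sum scaler_sumr -sumrB !big_seq; apply: eq_bigr => e es.
    by rewrite linearZ /= kb // !scalerA mulrBr scalerBl [k d1 d2 * _]mulrC.
  by rewrite mulf_eq0 (negbTE cd0) subr_eq0 => /eqP.
have supp d : d \in s -> c d != 0 -> d.1 = (d1, d2).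
  move=> ds cd0; have wb e : e \in s -> weight_space e.1.1 e.1.2 (b e).
    by move=> es; apply: (gt_wt mP); apply: (allP Ps).
  rewrite [d.1]surjective_pairing; apply: weight_inj.
    by apply: (cross i1 k1) => // e /wb[].
  by apply: (cross i2 k2) => // e /wb[].
(* Outside the list of indices the coefficient function is arbitrary. *)
exists (fun n => if (d1, d2, n) \in s then c (d1, d2, n) else 0).
pose t := [seq (d1, d2, k) | k <- index_iota 0 (minn d1 d2).+1].
have ut : uniq t by rewrite map_inj_uniq ?iota_uniq // => ? ? [].
transitivity (\sum_(d <- t) (if d \in s then c d else 0) *: b d); last first.
  by rewrite big_map.
rewrite (eq_bigr (fun d => if d \in s then c d *: b d else 0)); last first.
  by move=> d _; case: ifP => // _; rewrite scale0r.
rewrite -big_mkcond xE (bigID (mem t)) /= addrC big1_seq ?add0r.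
  rewrite -[LHS]big_filter -[RHS]big_filter; apply/perm_big/uniq_perm.
  - exact: filter_uniq.
  - exact: filter_uniq.
  - by move=> d; rewrite !mem_filter andbC.
move=> d /andP[dt ds]; have [->|cd0] := eqVneq (c d) 0; first exact: scale0r.
case/negP: dt; apply/mapP; exists d.2; last first.
  by rewrite -(supp d ds cd0) -surjective_pairing.
by rewrite mem_index_iota ltnS; have := allP Ps d ds; rewrite (supp d ds cd0).
Qed.

Lemma opE1_gt_comb0 (d2 : nat) (C : nat -> L) :
  opE A i1 (gt_comb 0 d2 C) = 0.
Proof.
rewrite /gt_comb min0n big_nat1 linearZ /= (gt_E1 mP) ?min0n //.
by rewrite gt_b1_n0 gt_b2_out !scale0r addr0 scaler0.
Qed.

(** The contribution of b_1 moves from index n + 1 to index n.  The ranges of n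
for (d1 + 1, d2) and (d1, d2) match up to terms with coefficient zero: if
d2 <= d1 nothing moves to n = d2, and b_1 vanishes at d2 + 1; if d1 < d2 the
source has the extra index n = d1 + 1, where b_2 vanishes. *)
Lemma opE1_gt_comb (d1 d2 : nat) (C : nat -> L) :
  opE A i1 (gt_comb d1.+1 d2 C) = gt_comb d1 d2 (fun n =>
    C n.+1 * gt_b1 br d1.+1 d2 n.+1 + C n * gt_b2 br d1.+1 d2 n).
Proof.
rewrite /gt_comb linear_sum.
transitivity (\sum_(0 <= n < (minn d1.+1 d2).+1)
   ((C n * gt_b1 br d1.+1 d2 n) *: m d1 d2 n.-1 +
    (C n * gt_b2 br d1.+1 d2 n) *: m d1 d2 n)).
  rewrite !big_mkord; apply: eq_bigr => i _.
  by rewrite linearZ /= (gt_E1 mP) -1?ltnS //= scalerDr !scalerA.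
rewrite big_split /= big_nat_recl //= gt_b1_n0 mulr0 scale0r add0r.
under [RHS]eq_bigr do rewrite scalerDl.
rewrite big_split /=; have [led|ltd] := leqP d2 d1.
  have -> : minn d1.+1 d2 = minn d1 d2 by lia.
  rewrite [in RHS]big_nat_recr //= (minn_idPr led).
  by rewrite gt_b1_out mulr0 scale0r addr0.
have -> : minn d1.+1 d2 = (minn d1 d2).+1 by lia.
rewrite [X in _ + X = _]big_nat_recr //= (minn_idPl (ltnW ltd)).
by rewrite gt_b2_out mulr0 scale0r addr0.
Qed.

Lemma opE2_gt_comb0 (d1 : nat) (C : nat -> L) :
  opE A i2 (gt_comb d1 0 C) = 0.
Proof.
rewrite /gt_comb minn0 big_nat1 linearZ /= (gt_E2 mP) ?minn0 //.
by rewrite gt_a_out scale0r scaler0.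
Qed.

Lemma opE2_gt_comb (d1 d2 : nat) (C : nat -> L) :
  opE A i2 (gt_comb d1 d2.+1 C) = gt_comb d1 d2 (fun n =>
    C n * gt_a br d1 d2.+1 n).
Proof.
rewrite /gt_comb linear_sum.
transitivity (\sum_(0 <= n < (minn d1 d2.+1).+1)
   (C n * gt_a br d1 d2.+1 n) *: m d1 d2 n).
  rewrite !big_mkord; apply: eq_bigr => i _.
  by rewrite linearZ /= (gt_E2 mP) -1?ltnS //= scalerA.
have [led|ltd] := leqP d1 d2; first by have -> : minn d1 d2.+1 = d1 by lia.
have -> : minn d1 d2.+1 = d2.+1 by lia.
by rewrite big_nat_recr //= gt_a_out mulr0 scale0r addr0.
Qed.

(** E_2 x = 0 forces the coefficients with n < d2 to vanish, because
sqrt a(d1, d2, n) <> 0 there; then E_1 x = 0 forces the one with n = d2. *)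
Lemma singular_eq0 (d1 d2 : nat) (x : V) : (0 < d1 + d2)%N ->
  weight_space d1 d2 x -> opE A i1 x = 0 -> opE A i2 x = 0 -> x = 0.
Proof.
move=> d_gt0 /weight_space_gt_comb[C ->] E1 E2.
suff C0 n : (n <= minn d1 d2)%N -> C n = 0.
  by rewrite /gt_comb big_mkord big1 // => i _; rewrite C0 ?scale0r // -ltnS.
case: d2 d_gt0 E1 E2 => [|d2] d_gt0 E1 E2 le_n.
  case: d1 d_gt0 E1 E2 le_n => // d1 _ E1 _; rewrite minn0 leqn0 => /eqP->.
  have /eqP := gt_comb_eq0 _ _ _
    (etrans (esym (opE1_gt_comb _ _ _)) E1) 0%N isT.
  rewrite gt_b1_out mulr0 add0r mulf_eq0 (negbTE (gt_b2_neq0 _ _ _ _)) //.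
  by rewrite orbF => /eqP.
have C0 k : (k <= minn d1 d2)%N -> C k = 0.
  move=> le_k.
  have /eqP := gt_comb_eq0 _ _ _ (etrans (esym (opE2_gt_comb _ _ _)) E2) k le_k.
  rewrite mulf_eq0 (negbTE (gt_a_neq0 _ _ _ _)) ?orbF => [/eqP //|].
  by apply: leq_trans le_k (geq_minr _ _).
have [/C0 //|] := leqP n (minn d1 d2).
case: d1 {d_gt0} E1 E2 le_n C0 => [|d1] E1 E2 le_n C0 gt_n; first by lia.
have [-> led] : n = d2.+1 /\ (d2 <= d1)%N by lia.
have le_d2 : (d2 <= minn d1 d2.+1)%N by lia.
have /eqP := gt_comb_eq0 _ _ _ (etrans (esym (opE1_gt_comb _ _ _)) E1) d2 le_d2.
rewrite [C d2]C0 ?mul0r ?addr0; last by lia.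
by rewrite mulf_eq0 (negbTE (gt_b1_neq0 _ _ _ _)) ?orbF // => /eqP.
Qed.

(** The common form of the Whittaker and dual Whittaker systems once K_1^-1 and
K_2 have been evaluated on weight vectors. *)
Definition raising (e1 e2 : nat -> nat -> L) (om : nat -> nat -> V) : Prop :=
  [/\ om 0%N 0%N = w,
      (forall d1 d2, weight_space d1 d2 (om d1 d2)),
      (forall d1 d2, opE A i1 (om d1 d2) = e1 d1 d2 *: shift1 om d1 d2) &
      (forall d1 d2, opE A i2 (om d1 d2) = e2 d1 d2 *: shift2 om d1 d2)].

Lemma raising_uniq (e1 e2 : nat -> nat -> L) (om om' : nat -> nat -> V) :
  raising e1 e2 om -> raising e1 e2 om' -> forall d1 d2, om d1 d2 = om' d1 d2.
Proof.
move=> [om00 wt_om E1om E2om] [om'00 wt_om' E1om' E2om'].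
suff H N d1 d2 : (d1 + d2 <= N)%N -> om d1 d2 = om' d1 d2.
  by move=> d1 d2; apply: H (leqnn _).
elim: N d1 d2 => [|N IHN] d1 d2 leN.
  have [-> ->] : d1 = 0%N /\ d2 = 0%N by lia.
  by rewrite om00 om'00.
have [d_eq0|d_gt0] := posnP (d1 + d2); first by apply: IHN; rewrite d_eq0.
apply/eqP; rewrite -subr_eq0; apply/eqP; apply: (singular_eq0 d1 d2) => //.
- rewrite addrC -scaleN1r; exact: weight_space_comb.
- rewrite linearB /= E1om E1om'; apply/eqP; rewrite subr_eq0; apply/eqP.
  by case: d1 leN {d_gt0} => //= d1 leN; rewrite IHN.
- rewrite linearB /= E2om E2om'; apply/eqP; rewrite subr_eq0; apply/eqP.
  by case: d2 leN {d_gt0} => //= d2 leN; rewrite IHN //; lia.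
Qed.

Lemma raising_gt_comb (e1 e2 : nat -> nat -> L) (C : nat -> nat -> nat -> L) :
  C 0%N 0%N 0%N = 1 ->
  (forall d1 d2 n, (n <= minn d1 d2)%N ->
     C d1.+1 d2 n.+1 * gt_b1 br d1.+1 d2 n.+1 +
     C d1.+1 d2 n * gt_b2 br d1.+1 d2 n
     = e1 d1.+1 d2 * C d1 d2 n) ->
  (forall d1 d2 n, (n <= minn d1 d2)%N ->
     C d1 d2.+1 n * gt_a br d1 d2.+1 n = e2 d1 d2.+1 * C d1 d2 n) ->
  raising e1 e2 (fun d1 d2 => gt_comb d1 d2 (C d1 d2)).
Proof.
move=> C000 C1 C2; split=> [|d1 d2|[|d1] d2|d1 [|d2]] /=.
- by rewrite /gt_comb big_nat1 C000 scale1r (gt_000 mP).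
- exact: weight_gt_comb.
- by rewrite opE1_gt_comb0 scaler0.
- by rewrite opE1_gt_comb gt_combZ; apply: eq_gt_comb => n /C1.
- by rewrite opE2_gt_comb0 scaler0.
- by rewrite opE2_gt_comb gt_combZ; apply: eq_gt_comb => n /C2.
Qed.

End RaisingSystem.

Arguments weight_space {L V}.
Arguments gt_comb {L V}.
Arguments raising {L V}.

(** * Quantum numbers *)

Section GenericParameters.

Variables (L : fieldType) (v t1 t2 : L).
Hypotheses (v_neq0 : v != 0) (t1_neq0 : t1 != 0) (t2_neq0 : t2 != 0).
Hypothesis qpow_eq1 : forall x, qpow v t1 t2 x = 1 -> x = 0.

Local Notation "v^[ x ]" := (qpow v t1 t2 x) (format "v^[ x ]").
Local Notation qn := (qnum v t1 t2).

Lemma qpow0 : v^[0] = 1.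
Proof. by rewrite /qpow !expr0z !mulr1. Qed.

Lemma qpowD (x y : qexp) : v^[x + y] = v^[x] * v^[y].
Proof. by rewrite /qpow /= !expfzDr //; ring. Qed.

Lemma qpow_neq0 (x : qexp) : v^[x] != 0.
Proof. by rewrite /qpow !mulf_neq0 // expfz_neq0. Qed.

Lemma qpowN (x : qexp) : v^[- x] = v^[x]^-1.
Proof.
by apply: (mulIf (qpow_neq0 x)); rewrite -qpowD addNr qpow0 mulVf ?qpow_neq0.
Qed.

Lemma qpow_inj : injective (qpow v t1 t2).
Proof.
move=> x y xy; apply/eqP; rewrite -subr_eq0; apply/eqP/qpow_eq1.
by rewrite qpowD qpowN xy mulfV ?qpow_neq0.
Qed.

Lemma qpow_cst (k : int) : v^[cst k] = v ^ k.
Proof. by rewrite /qpow /= !expr0z !mul1r. Qed.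

Lemma sqr_v_neq1 : v ^+ 2 != 1.
Proof.
by apply/eqP => v2; have := qpow_eq1 (cst 2); rewrite qpow_cst => /(_ v2).
Qed.

Lemma vBV_neq0 : v - v^-1 != 0.
Proof.
apply: contra sqr_v_neq1; rewrite subr_eq0 => /eqP vE.
by rewrite expr2 {1}vE mulVf.
Qed.

Lemma qnum_neq0 (x : qexp) : x != 0 -> qn x != 0.
Proof.
apply: contra_neq => /eqP; rewrite mulf_eq0 invr_eq0 (negbTE vBV_neq0) orbF.
rewrite subr_eq0 => /eqP/qpow_inj/eqP; rewrite -subr_eq0 opprK => /eqP.
case: x => [[a b] c] [] /= ha hb hc; congr (_, _, _); lia.
Qed.

(** This identity and its image under v -> v^-1 are the equations for E_1. *)
Lemma qnum_addl (x a : qexp) : v^[x] * qn a + qn (x - a) = v^[a] * qn x.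
Proof.
rewrite /qnum !(qpowD, qpowN, opprD, opprK); field.
by rewrite v_neq0 subr_eq0 -?expr2 sqr_v_neq1 !qpow_neq0.
Qed.

Lemma qnum_addlN (x a : qexp) : v^[- x] * qn a + qn (x - a) = v^[- a] * qn x.
Proof.
rewrite /qnum !(qpowD, qpowN, opprD, opprK); field.
by rewrite v_neq0 subr_eq0 -?expr2 sqr_v_neq1 !qpow_neq0.
Qed.

Lemma weight_exponent_inj (a b : qexp) (d1 d2 e1 e2 : nat) :
  v^[a + cst (- 2 * d1%:Z + d2%:Z)] = v^[a + cst (- 2 * e1%:Z + e2%:Z)] ->
  v^[b + cst (- 2 * d2%:Z + d1%:Z)] = v^[b + cst (- 2 * e2%:Z + e1%:Z)] ->
  (d1, d2) = (e1, e2).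
Proof.
move=> /qpow_inj/addrI[h1] /qpow_inj/addrI[h2].
by congr (_, _); lia.
Qed.

Lemma weight_exponent_inj_dual (a b : qexp) (d1 d2 e1 e2 : nat) :
  v^[a + cst (2 * d1%:Z - d2%:Z)] = v^[a + cst (2 * e1%:Z - e2%:Z)] ->
  v^[b + cst (2 * d2%:Z - d1%:Z)] = v^[b + cst (2 * e2%:Z - e1%:Z)] ->
  (d1, d2) = (e1, e2).
Proof.
move=> /qpow_inj/addrI[h1] /qpow_inj/addrI[h2].
by congr (_, _); lia.
Qed.

Variable sq : qexp -> L.
Hypothesis sqP : qsqrt_choice v t1 t2 sq.

Lemma sq0 : sq 0 = 0. Proof. by case: sqP. Qed.

Lemma sq_sqr (x : qexp) : has_qsqrt x -> sq x ^+ 2 = qn x.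
Proof. by case: sqP => _; apply. Qed.

Lemma sq_neq0 (x : qexp) : has_qsqrt x -> sq x != 0.
Proof.
move=> hx; rewrite -sqrf_eq0 sq_sqr //; exact/qnum_neq0/has_qsqrt_neq0.
Qed.

Lemma whit_c_sq_b2 (d1 d2 n : nat) : (n <= minn d1 d2)%N ->
  whit_c sq d1.+1 d2 n * gt_b2 sq d1.+1 d2 n = whit_c sq d1 d2 n *
    (qn (lam2 - lam3 + cst (d1.+1%:Z - d2%:Z - n%:Z)) /
     qn (lam2 - lam3 + cst (d1.+1%:Z - 2 * n%:Z))).
Proof.
rewrite leq_min => /andP[led1 led2].
rewrite (whit_c_b2 _ _ sq_neq0) // !sq_sqr //; exact: has_qsqrt23.
Qed.

Lemma whit_c_sq_b1 (d1 d2 n : nat) : (n <= minn d1 d2)%N ->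
  whit_c sq d1.+1 d2 n.+1 * gt_b1 sq d1.+1 d2 n.+1 = whit_c sq d1 d2 n *
    (qn (cst (d2%:Z - n%:Z)) /
     qn (lam2 - lam3 + cst (d1.+1%:Z - 2 * n%:Z))).
Proof.
rewrite leq_min => /andP[led1]; rewrite leq_eqVlt => /predU1P[->|ltd2].
  rewrite gt_b1_out ?sq0 // subrr [qnum _ _ _ (cst 0)]mulrBl subrr.
  by rewrite mul0r !mulr0.
rewrite (whit_c_b1 _ _ sq_neq0) // !sq_sqr //; first exact: has_qsqrt23.
have -> : d2%:Z - n%:Z = (d2 - n.+1).+1%:Z by lia. apply: has_qsqrt_cst.
Qed.

(** The power v^a in [qnum_addl] is what remains of the scalar of K_1 once the
change of r along d1 is taken off. *)
Lemma whit_rS1 (d1 d2 n : nat) :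
  whit_r d1.+1 d2 n + (cst (d2%:Z - n%:Z)) =
  lam1 - lam2 + cst (- 2 * d1.+1%:Z + d2%:Z) + whit_r d1 d2 n.
Proof. by rewrite !whit_rE; apply: qexp_eq; rewrite /= ?intS; ring. Qed.

(** The power v^X in [qnum_addl], for d1 + 1 in place of d1. *)
Lemma whit_rSn (d1 d2 n : nat) : whit_r d1 d2 n.+1 =
  whit_r d1 d2 n + (lam2 - lam3 + cst (d1%:Z - 2 * n%:Z)).
Proof. by rewrite !whit_rE; apply: qexp_eq; rewrite /= ?intS; ring. Qed.

Lemma whit_r_d2 (d1 d2 d2' n : nat) : whit_r d1 d2 n = whit_r d1 d2' n.
Proof. by []. Qed.

Lemma whit_s_S1 (d1 d2 : nat) : whit_s d1.+1 d2 =
  whit_s d1 d2 + (lam1 - lam2 + cst (- 2 * d1.+1%:Z + d2%:Z)) + cst 1.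
Proof. by rewrite !whit_sE; apply: qexp_eq; rewrite /= ?intS; ring. Qed.

Lemma whit_s_S2 (d1 d2 : nat) : whit_s d1 d2.+1 =
  whit_s d1 d2 - (lam3 - lam2 + cst (2 * d2.+1%:Z - d1%:Z)) + cst 1.
Proof. by rewrite !whit_sE; apply: qexp_eq; rewrite /= ?intS; ring. Qed.

Section Coefficients.

Variables (u : L) (ex : nat -> nat -> nat -> qexp) (f1 f2 : nat -> nat -> L).
Hypothesis u_neq0 : u != 0.

(** The coefficient shared by both vectors: only the exponent [ex] and the unit
[u] = 1 - v^(2 or -2) differ. *)
Definition whit_coef (d1 d2 n : nat) : L :=
  v^[ex d1 d2 n] / u ^+ (d1 + d2) * whit_c sq d1 d2 n.

(** After the cancellations in c, the existence of a solution depends only on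
how the exponent [ex] varies. *)
Lemma whit_coef_raising (V : lmodType L) (A : uq_ops V) (w : V)
    (k1 k2 : nat -> nat -> L) (m : nat -> nat -> nat -> V) :
  gt_basis A w (weight_space A k1 k2) sq m ->
  ex 0%N 0%N 0%N = 0 ->
  (forall d1 d2 n, let x := lam2 - lam3 + cst (d1.+1%:Z - 2 * n%:Z) in
     let a := cst (d2%:Z - n%:Z) in
     v^[ex d1.+1 d2 n.+1] * qn a + v^[ex d1.+1 d2 n] * qn (x - a)
     = f1 d1.+1 d2 * v^[ex d1 d2 n] * qn x) ->
  (forall d1 d2 n, v^[ex d1 d2.+1 n] = f2 d1 d2.+1 * v^[ex d1 d2 n]) ->
  raising A w k1 k2 (fun d1 d2 => f1 d1 d2 / u) (fun d1 d2 => f2 d1 d2 / u)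
    (fun d1 d2 => gt_comb m d1 d2 (whit_coef d1 d2)).
Proof.
move=> mP ex0 ex1 ex2; apply: (raising_gt_comb _ _ sq0 _ _ _ _ _ _ mP).
- by rewrite /whit_coef ex0 qpow0 whit_c000 expr0 divr1 mulr1.
- move=> d1 d2 n le_n; rewrite /whit_coef -![_ / _ * _ * _]mulrA.
  rewrite whit_c_sq_b1 // whit_c_sq_b2 //.
  have := ex1 d1 d2 n; rewrite /= -addrA -cstD.
  have -> : d1.+1%:Z - 2 * n%:Z - (d2%:Z - n%:Z) = d1.+1%:Z - d2%:Z - n%:Z.
    by lia.
  have := qnum_neq0 _ (has_qsqrt_neq0 _ (has_qsqrt23 (d1.+1%:Z - 2 * n%:Z))).
  set X := qn (_ + cst (d1.+1%:Z - 2 * n%:Z)) => X0 eq1.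
  apply: (mulfI X0); rewrite addSn exprS.
  transitivity (whit_c sq d1 d2 n / (u * u ^+ (d1 + d2)) *
    (f1 d1.+1 d2 * v^[ex d1 d2 n] * X)); first rewrite -eq1; field.
    by rewrite X0 u_neq0 expf_neq0.
  by rewrite u_neq0 expf_neq0.
- move=> d1 d2 n; rewrite leq_min => /andP[le1 le2].
  rewrite /whit_coef -[_ / _ * _ * _]mulrA (whit_c_a _ _ sq_neq0) // ex2.
  rewrite addnS exprS.
  by field; rewrite u_neq0 expf_neq0.
Qed.

End Coefficients.

Section Modules.

Variables (q : L) (V : lmodType L) (A : uq_ops V) (w : V).
Hypothesis modA : uq_module q A.

Lemma opKV_eigen (i : 'I_2) (k : L) (x : V) :
  k != 0 -> opK A i x = k *: x -> opKV A i x = k^-1 *: x.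
Proof.
move=> k0 Kx; rewrite -[RHS](uq_KVK modA i) linearZ /= Kx.
by rewrite scalerA mulVf // scale1r.
Qed.

Variable m : nat -> nat -> nat -> V.

Lemma raising_unique_solution (k1 k2 e1 e2 : nat -> nat -> L)
    (P : (nat -> nat -> V) -> Prop) (om0 : nat -> nat -> V) :
  (forall d1 d2 c1 c2, k1 d1 d2 = k1 c1 c2 -> k2 d1 d2 = k2 c1 c2 ->
     (d1, d2) = (c1, c2)) ->
  gt_basis A w (weight_space A k1 k2) sq m ->
  (forall om, P om <-> raising A w k1 k2 e1 e2 om) ->
  raising A w k1 k2 e1 e2 om0 ->
  (exists! om, P om) /\
  (forall om, P om -> forall d1 d2, om d1 d2 = om0 d1 d2).
Proof.
move=> k_inj mP PE om0P.
have uniq om : P om -> forall d1 d2, om d1 d2 = om0 d1 d2.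
  move=> /PE omP.
  exact: (raising_uniq _ _ sq0 sq_neq0 _ _ _ _ _ _ k_inj mP) omP om0P.
split=> //; exists om0; split=> [|om Pom]; first exact/PE.
by apply/funext => d1; apply/funext => d2; rewrite uniq.
Qed.

(** On a component K_1^-1 is the inverse of the weight, a nonzero scalar. *)
Lemma whittakerP (om : nat -> nat -> V) : whittaker v t1 t2 A w om <->
  raising A w
    (fun d1 d2 => v^[lam1 - lam2 + cst (- 2 * d1%:Z + d2%:Z)])
    (fun d1 d2 => v^[lam2 - lam3 + cst (- 2 * d2%:Z + d1%:Z)])
    (fun d1 d2 => v^[lam1 - lam2 + cst (- 2 * d1%:Z + d2%:Z)] / (1 - v ^+ 2))
    (fun d1 d2 => 1 / (1 - v ^+ 2)) om.
Proof.
suff E1 : (forall d1 d2, wtspace v t1 t2 A d1 d2 (om d1 d2)) -> forall d1 d2,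
    opE A i1 (opKV A i1 (om d1 d2)) = (1 / (1 - v ^+ 2)) *: shift1 om d1 d2 <->
    opE A i1 (om d1 d2) = (v^[lam1 - lam2 + cst (- 2 * d1%:Z + d2%:Z)]
                           / (1 - v ^+ 2)) *: shift1 om d1 d2.
  by split=> -[om00 wt Eom1 Eom2]; split=> // d1 d2; apply/E1.
move=> wt d1 d2; set k := v^[_]; have k0 : k != 0 by apply: qpow_neq0.
rewrite (opKV_eigen _ k) //; last by case: (wt d1 d2).
rewrite linearZ /= div1r -[in X in _ <-> X]scalerA.
by split=> [<-|->]; rewrite ?scalerK ?scalerKV.
Qed.

Lemma dual_whittakerP (om : nat -> nat -> V) : dual_whittaker v t1 t2 A w om <->
  raising A w
    (fun d1 d2 => v^[lam2 - lam1 + cst (2 * d1%:Z - d2%:Z)])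
    (fun d1 d2 => v^[lam3 - lam2 + cst (2 * d2%:Z - d1%:Z)])
    (fun d1 d2 => v / (1 - v ^- 2))
    (fun d1 d2 => v^[- (lam3 - lam2 + cst (2 * d2%:Z - d1%:Z)) + cst 1]
                  / (1 - v ^- 2)) om.
Proof.
suff E2 : (forall d1 d2, wtspace_dual v t1 t2 A d1 d2 (om d1 d2)) ->
    forall d1 d2,
    opE A i2 (opK A i2 (om d1 d2)) = (v / (1 - v ^- 2)) *: shift2 om d1 d2 <->
    opE A i2 (om d1 d2) = (v^[- (lam3 - lam2 + cst (2 * d2%:Z - d1%:Z)) + cst 1]
                           / (1 - v ^- 2)) *: shift2 om d1 d2.
  by split=> -[om00 wt Eom1 Eom2]; split=> // d1 d2; apply/E2.
move=> wt d1 d2; rewrite qpowD qpowN qpow_cst expr1z -mulrA.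
rewrite -[in X in _ <-> X]scalerA.
have [_ ->] := wt d1 d2; set k := v^[_]; have k0 : k != 0 by apply: qpow_neq0.
by rewrite linearZ /=; split=> [<-|->]; rewrite ?scalerK ?scalerKV.
Qed.

Lemma whittaker_gt : gt_basis A w (wtspace v t1 t2 A) sq m ->
  (exists! om, whittaker v t1 t2 A w om) /\
  (forall om, whittaker v t1 t2 A w om ->
     forall d1 d2, om d1 d2 = \sum_(0 <= n < (minn d1 d2).+1)
       whittaker_term v t1 t2 sq m d1 d2 n).
Proof.
move=> mP; apply: (raising_unique_solution _ _ _ _ _ _ _ mP whittakerP).
  exact: weight_exponent_inj.
apply: (whit_coef_raising _ whit_r (fun d1 d2 =>
  v^[lam1 - lam2 + cst (- 2 * d1%:Z + d2%:Z)]) (fun _ _ => 1)) => //.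
- by rewrite subr_eq0 eq_sym sqr_v_neq1.
- move=> d1 d2 n x a; rewrite whit_rSn -/x -qpowD -whit_rS1 -/a.
  rewrite (qpowD _ x) (qpowD _ a).
  by rewrite -(mulrA _ v^[x]) -(mulrA _ v^[a]) -mulrDr qnum_addl.
- by move=> d1 d2 n; rewrite mul1r.
Qed.

Lemma dual_whittaker_gt : gt_basis A w (wtspace_dual v t1 t2 A) sq m ->
  (exists! om, dual_whittaker v t1 t2 A w om) /\
  (forall om, dual_whittaker v t1 t2 A w om ->
     forall d1 d2, om d1 d2 = \sum_(0 <= n < (minn d1 d2).+1)
       dual_whittaker_term v t1 t2 sq m d1 d2 n).
Proof.
move=> mP; apply: (raising_unique_solution _ _ _ _ _ _ _ mP dual_whittakerP).
  exact: weight_exponent_inj_dual.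
apply: (whit_coef_raising _ (fun d1 d2 n => - whit_r d1 d2 n + whit_s d1 d2)
  (fun _ _ => v)
  (fun d1 d2 => v^[- (lam3 - lam2 + cst (2 * d2%:Z - d1%:Z)) + cst 1])) => //.
- by rewrite subr_eq0 eq_sym invr_eq1 sqr_v_neq1.
- move=> d1 d2 n x a; rewrite whit_rSn -/x opprD -addrA [- x + _]addrC addrA.
  rewrite (qpowD _ (- x)) -(mulrA _ v^[- x]) -mulrDr qnum_addlN mulrA -qpowD.
  congr (_ * _).
  transitivity (v^[cst 1] * v^[- whit_r d1 d2 n + whit_s d1 d2]); last first.
    by rewrite qpow_cst expr1z.
  rewrite -qpowD; congr (qpow _ _ _ _).
  have /(canRL (addrK _)) -> := whit_rS1 d1 d2 n; rewrite -/a whit_s_S1.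
  rewrite !opprD opprK; ring.
- move=> d1 d2 n; apply: etrans (qpowD _ _); congr (qpow _ _ _ _).
  by rewrite whit_s_S2 (whit_r_d2 _ _ d2); ring.
Qed.

End Modules.

End GenericParameters.

(** * The formal variables *)

Section FormalVariablesGeneric.

Variable R : realType.

Definition ratfun_mono (p : 'I_3 -> nat) : ratfun R :=
  \prod_(i < 3) ratfun_var R i ^+ p i.

(** Distinct monomials are distinct elements of the fraction field: algebraic
independence of the three variables. *)
Lemma ratfun_mono_inj (p q : 'I_3 -> nat) :
  ratfun_mono p = ratfun_mono q -> p =1 q.
Proof.
have monoE r : ratfun_mono r =
    tofrac ('X_[[multinom r i | i < 3]] : {mpoly R[i][3]}).
  rewrite mpolyXE_id rmorph_prod; apply: eq_bigr => i _.
  by rewrite mnmE rmorphXn.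
rewrite !monoE => /eqP; rewrite tofrac_eq.
move=> /eqP/(congr1 (mcoeff [multinom q i | i < 3])); rewrite !mcoeffX eqxx.
case: eqP => [pq _ i|_ /eqP]; last by rewrite eq_sym oner_eq0.
by have := congr1 (fun u : 'X_{1..3} => u i) pq; rewrite !mnmE.
Qed.

Lemma ratfun_var_neq0 (k : 'I_3) : ratfun_var R k != 0.
Proof.
rewrite /ratfun_var tofrac_eq0; apply/eqP => /(congr1 (mcoeff U_(k)%MM)).
by rewrite mcoeffX eqxx mcoeff0 => /eqP; rewrite oner_eq0.
Qed.

Lemma int_subn (z : int) : exists p : nat * nat, z = p.1%:Z - p.2%:Z.
Proof.
case: z => n; first by exists (n, 0%N); rewrite subr0.
by exists (0%N, n.+1); rewrite sub0r.
Qed.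

(** Clearing denominators in a Laurent monomial, which reduces the independence
of integer powers to that of monomials. *)
Lemma laurent_eq1 (F : fieldType) (x y z : F) (a b c a' b' c' : nat) :
  x != 0 -> y != 0 -> z != 0 ->
  x ^ (a%:Z - a'%:Z) * y ^ (b%:Z - b'%:Z) * z ^ (c%:Z - c'%:Z) = 1 ->
  x ^+ a * y ^+ b * z ^+ c = x ^+ a' * y ^+ b' * z ^+ c'.
Proof.
move=> x0 y0 z0; rewrite !expfzDr // -!exprnN -!exprnP => E.
rewrite -[RHS]mul1r -E; field.
by rewrite !expf_neq0.
Qed.

Lemma ratfun_qpow_eq1 (x : qexp) :
  qpow (ratfun_var R 0) (ratfun_var R 1) (ratfun_var R 2) x = 1 -> x = 0.
Proof.
case: x => [[a b] c]; have [p ->] := int_subn c.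
have [q ->] := int_subn a; have [r ->] := int_subn b.
move=> /laurent_eq1 E.
pose f (x y z : nat) (i : 'I_3) := nth 0%N [:: x; y; z] i.
have monoE x y z : ratfun_mono (f x y z) =
    ratfun_var R 1 ^+ y * ratfun_var R 2 ^+ z * ratfun_var R 0 ^+ x.
  rewrite /ratfun_mono 2!big_ord_recl big_ord1 /f /= [RHS]mulrC.
  by congr (_ ^+ _ * (_ ^+ _ * _ ^+ _)); congr ratfun_var; apply: val_inj.
have /ratfun_mono_inj pq :
    ratfun_mono (f p.1 q.1 r.1) = ratfun_mono (f p.2 q.2 r.2).
  by rewrite !monoE E ?ratfun_var_neq0.
by have := (pq 0, pq 1, pq 2); rewrite /f /= => -[[-> ->] ->]; rewrite !subrr.
Qed.

Variables (K : fieldType) (iota : {rmorphism ratfun R -> K}).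

Lemma sqrt_ring_in_neq0 (f : ratfun R) : f != 0 -> sqrt_ring_in iota f != 0.
Proof.
move=> f0; apply/eqP => /(congr1 val)/eqP.
by rewrite (fmorph_eq0 iota) (negbTE f0).
Qed.

Lemma formal_qpow_eq1 (x : qexp) :
  qpow (vv iota) (vlam1 iota) (vlam2 iota) x = 1 -> x = 0.
Proof.
move=> /(congr1 val) E; apply: ratfun_qpow_eq1; apply: (fmorph_inj iota).
by rewrite rmorph1 -[RHS]E /qpow !rmorphM !fmorphXz.
Qed.

End FormalVariablesGeneric.

Theorem theorem8p6
    (R : realType)
    (* K, with iota, is an algebraic closure of C(v, v^lambda_1, v^lambda_2) *)
    (K : closedFieldType) (iota : {rmorphism ratfun R -> K})
    (K_alg : forall x : K, algebraicOver iota x)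
    (sq : qexp -> sqrt_ring iota)
    (sqP : qsqrt_choice (vv iota) (vlam1 iota) (vlam2 iota) sq)
    (* the Verma module over U_v(sl_3) and its Gelfand-Tsetlin basis *)
    (V : lmodType (sqrt_ring iota)) (A : uq_ops V) (w : V)
    (V_verma : verma (vv iota)
       (qpow (vv iota) (vlam1 iota) (vlam2 iota) (lam1 - lam2))
       (qpow (vv iota) (vlam1 iota) (vlam2 iota) (lam2 - lam3)) A w)
    (m : nat -> nat -> nat -> V)
    (mP : gt_basis A w (wtspace (vv iota) (vlam1 iota) (vlam2 iota) A) sq m)
    (* the Verma module over U_{v^-1}(sl_3) and its Gelfand-Tsetlin basis *)
    (V' : lmodType (sqrt_ring iota)) (A' : uq_ops V') (w' : V')
    (V'_verma : verma (vv iota)^-1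
       (qpow (vv iota) (vlam1 iota) (vlam2 iota) (lam2 - lam1))
       (qpow (vv iota) (vlam1 iota) (vlam2 iota) (lam3 - lam2)) A' w')
    (m' : nat -> nat -> nat -> V')
    (m'P : gt_basis A' w'
       (wtspace_dual (vv iota) (vlam1 iota) (vlam2 iota) A') sq m') :
  ((exists! om, whittaker (vv iota) (vlam1 iota) (vlam2 iota) A w om) /\
   (forall om, whittaker (vv iota) (vlam1 iota) (vlam2 iota) A w om ->
      forall d1 d2, om d1 d2 = \sum_(0 <= n < (minn d1 d2).+1)
        whittaker_term (vv iota) (vlam1 iota) (vlam2 iota) sq m d1 d2 n)) /\
  ((exists! om, dual_whittaker (vv iota) (vlam1 iota) (vlam2 iota) A' w' om) /\
   (forall om, dual_whittaker (vv iota) (vlam1 iota) (vlam2 iota) A' w' om ->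
      forall d1 d2, om d1 d2 = \sum_(0 <= n < (minn d1 d2).+1)
        dual_whittaker_term (vv iota) (vlam1 iota) (vlam2 iota) sq m' d1 d2 n)).
Proof.
have v0 : vv iota != 0 by apply/sqrt_ring_in_neq0/ratfun_var_neq0.
have t10 : vlam1 iota != 0 by apply/sqrt_ring_in_neq0/ratfun_var_neq0.
have t20 : vlam2 iota != 0 by apply/sqrt_ring_in_neq0/ratfun_var_neq0.
have generic := formal_qpow_eq1 R K iota.
split.
  exact: (whittaker_gt _ _ _ _ v0 t10 t20 generic sq sqP _ V A w
            (verma_module V_verma) m mP).
exact: (dual_whittaker_gt _ _ _ _ v0 t10 t20 generic sq sqP V' A' w' m' m'P).
Qed.
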